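(* Let $\omega$ be a weight function on the 5-cycle $C_5$ with $|\omega(v)-\frac15|\le\frac1{50}$ for every $v\in V(C_5)$. Then the weighted graph $(C_5,\omega)$ has a $\frac1{30}$-uniform sparse half.
   Context: A weight function on a graph assigns weights in $(0,1)$ summing to $1$; $\omega(uv)=\omega(u)\omega(v)$. A half of $(G,\omega)$ is $s:V(G)\to\mathbb{R}_{\ge0}$ with $s(v)\le\omega(v)$ and $\sum_v s(v)=1/2$, and $s(uv)=s(u)s(v)$. A $c$-uniform sparse half is a probability distribution $\mathbf s$ on the set of halves with $\mathbb E[\mathbf s(e)]\ge c\,\omega(e)$ for every edge $e$ and $\mathbb E[\sum_{e\in E(G)}\mathbf s(e)]\le 1/50$. (The hypothesis is the paper's ''$(1/50)$-balanced'' condition for $C_5$, whose maximum independent sets are all vertex neighbourhoods.) *)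

(* Defs.v *)
From HB Require Import structures.
From mathcomp Require Import all_boot all_order all_algebra.

Set Implicit Arguments.
Unset Strict Implicit.
Unset Printing Implicit Defensive.

Import Order.TTheory GRing.Theory Num.Theory.
Local Open Scope ring_scope.

Record sgraph (V : finType) := SGraph {
  adj :> rel V;
  adj_sym : symmetric adj;
  adj_irr : irreflexive adj }.

Definition edges (V : finType) (G : sgraph V) : {set {set V}} :=
  [set [set p.1; p.2] | p in [pred p : V * V | G p.1 p.2]].

(* The extension of a vertex function to edges, f(uv) = f(u)f(v): see
   [edge_valE]. *)
Definition edge_val (R : comNzRingType) (V : finType) (f : V -> R)
    (e : {set V}) : R :=
  \prod_(v in e) f v.

Lemma edge_valE (R : comNzRingType) (V : finType) (G : sgraph V) (f : V -> R)
    (u v : V) : G u v -> edge_val f [set u; v] = f u * f v.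
Proof.
move=> Guv; rewrite /edge_val big_setU1 ?big_set1 // inE.
by apply/negP => /eqP uv; rewrite uv adj_irr in Guv.
Qed.

(* Addition is modulo 5 in 'I_5. *)
Definition C5_adj : rel 'I_5 := fun u v => (v == u + 1) || (u == v + 1).

Lemma C5_adj_sym : symmetric C5_adj.
Proof. by move=> u v; rewrite /C5_adj orbC. Qed.

Lemma C5_adj_irr : irreflexive C5_adj.
Proof. by move=> u; rewrite /C5_adj orbb -subr_eq0 opprD addNKr. Qed.

Definition C5 : sgraph 'I_5 := SGraph C5_adj_sym C5_adj_irr.

From mathcomp Require Import all_classical all_reals all_analysis.
Local Open Scope classical_set_scope.

Record weight (R : realType) (V : finType) := Weight {
  weight_fun :> V -> R;
  weight_itv : forall v, 0 < weight_fun v < 1;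
  weight_sum : \sum_v weight_fun v = 1 }.

Record half_of (R : realType) (V : finType) (w : weight R V) := Half {
  half_fun :> V -> R;
  half_ge0 : forall v, 0 <= half_fun v;
  half_le : forall v, half_fun v <= w v;
  half_sum : \sum_v half_fun v = 1 / 2 }.

Section half_measurable.
Variables (R : realType) (V : finType) (w : weight R V).

HB.instance Definition _ := gen_eqMixin (half_of w).
HB.instance Definition _ := gen_choiceMixin (half_of w).

Let half_weight_ge0 v : 0 <= w v / 2.
Proof. by have /andP[w0 _] := weight_itv w v; rewrite divr_ge0 // ltW. Qed.

Let half_weight_le v : w v / 2 <= w v.
Proof.
have /andP[w0 _] := weight_itv w v.
by rewrite ler_pdivrMr // mulr_natr mulr2n lerDl ltW.
Qed.

Let half_weight_sum : \sum_v w v / 2 = 1 / 2.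
Proof. by rewrite -mulr_suml weight_sum. Qed.

(* The library requires measurable types to be inhabited. *)
Definition half_weight : half_of w :=
  Half half_weight_ge0 half_weight_le half_weight_sum.

HB.instance Definition _ := isPointed.Build (half_of w) half_weight.

(* The cylinder sets, which generate the Borel sigma-algebra induced on the
   halves by R^V. *)
Definition half_cylinders : set (set (half_of w)) :=
  \bigcup_(v in [set: V])
    preimage_set_system setT (fun s : half_of w => s v) measurable.

Definition halves := g_sigma_algebraType half_cylinders.

HB.instance Definition _ := Measurable.on halves.

Lemma measurable_half_eval (v : V) :
  measurable_fun setT (fun s : halves => half_fun s v).
Proof.
by move=> _ B mB; apply: sub_sigma_algebra; exists v => //; exists B.
Qed.

End half_measurable.

Section uniform_sparse_half.
Local Open Scope ereal_scope.

Definition is_uniform_sparse_half (R : realType) (V : finType) (G : sgraph V)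
    (w : weight R V) (c : R) (P : probability (halves w) R) : Prop :=
  (forall e : {set V}, e \in edges G ->
     (c * edge_val w e)%:E <= 'E_P[fun s => edge_val (half_fun s) e]) /\
  'E_P[fun s => (\sum_(e in edges G) edge_val (half_fun s) e)%R]
     <= (1 / 50)%:E.

Definition has_uniform_sparse_half (R : realType) (V : finType)
    (G : sgraph V) (w : weight R V) (c : R) : Prop :=
  exists P : probability (halves w) R, is_uniform_sparse_half G c P.

End uniform_sparse_half.

(* Main.v *)
Require Import Defs.
From HB Require Import structures.
From mathcomp Require Import all_boot all_order all_algebra.
From mathcomp Require Import all_classical all_reals all_analysis.
From mathcomp Require Import measurable_realfun measurable_fun_approximation.
From mathcomp Require Import ring lra.

(* For each vertex v and direction d = +1 or -1, fill the independent set
   {v - d, v + d} and put the missing mass r_v = 1/2 - x_v, where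
   x_v = w(v+1) + w(v-1), on v + 2d.  The only edge of this half that carries
   weight is {v + d, v + 2d}, of weight w(v + d) r_v.  Choose v and d uniformly
   at random: the expected total weight is the mean of x_v (1/2 - x_v) / 2,
   which is at most 1/50 because x (1/2 - x) is concave and the mean of the x_v
   is 2/5.  Every edge {i, i+1} is hit by two of the ten halves, with expected
   weight (w(i) r_(i-1) + w(i+1) r_(i+2)) / 10, and r >= 3/50 suffices. *)

Set Implicit Arguments.
Unset Strict Implicit.
Unset Printing Implicit Defensive.

Import Order.TTheory GRing.Theory Num.Theory.
Local Open Scope ring_scope.

(** The law of [h i] for uniform [i], built as a sum of scaled Dirac masses; [i0] makes [I]
    nonempty, hence the total mass 1. Nonnegativity of [f] lets the integral split over the sum
    without integrability conditions. *)
Lemma uniform_mixture (d : measure_display) (T : measurableType d)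
    (R : realType) (I : finType) (i0 : I) (h : I -> T) :
  exists P : probability T R, forall f : T -> R,
    measurable_fun setT f -> (forall x, 0 <= f x) ->
    ('E_P[f] = (#|I|%:R^-1 * \sum_i f (h i))%:E)%E.
Proof.
have c0 : 0 <= #|I|%:R^-1 :> R by rewrite invr_ge0.
pose nu k : {measure set T -> \bar R} :=
  mscale (NngNum c0) (dirac (h (nth i0 (enum I) k))).
pose mu : {measure set T -> \bar R} := msum nu #|I|.
have muE (f : T -> R) : measurable_fun setT f -> (forall x, 0 <= f x) ->
    (\int[mu]_x (f x)%:E = (#|I|%:R^-1 * \sum_i f (h i))%:E)%E.
  move=> mf f0; have mEf : measurable_fun setT (fun x => (f x)%:E).
    exact/measurable_EFinP.
  have f0E x : (0 <= (f x)%:E)%E by rewrite lee_fin.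
  rewrite ge0_integral_measure_sum //.
  under eq_bigr => k _.
    rewrite ge0_integral_mscale // integral_dirac // diracT mul1e -EFinM.
    over.
  rewrite sumEFin -mulr_sumr; congr (_ * _)%:E.
  rewrite -[RHS]big_enum /= (big_nth i0) -cardE big_mkord.
  by [].
have mu1 : mu setT = 1%E.
  have := muE _ (measurable_cst (1 : R)) (fun=> ler01).
  rewrite (integral_cst mu measurableT 1) mul1e => ->.
  rewrite sumr_const mulVf // pnatr_eq0 -lt0n.
  by apply/card_gt0P; exists i0.
pose P : probability T R :=
  HB.pack (mu : set T -> \bar R) mu (Measure_isProbability.Build _ _ _ mu mu1).
exists P => f mf f0.
by rewrite unlock; exact: muE.
Qed.

Lemma measurable_edge_val (R : realType) (V : finType) (w : weight R V)
    (e : {set V}) :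
  measurable_fun setT (fun s : halves w => edge_val (half_fun s) e).
Proof.
rewrite /edge_val; under eq_fun do rewrite -big_enum /=.
by apply: measurable_prod => v _; exact: measurable_half_eval.
Qed.

Lemma edge_val_half_ge0 (R : realType) (V : finType) (w : weight R V)
    (s : half_of w) (e : {set V}) : 0 <= edge_val s e.
Proof. by apply: prodr_ge0 => v _; exact: half_ge0. Qed.

Lemma edges_C5 : edges C5 = [set [set i; i + 1] | i : 'I_5].
Proof.
apply/setP => e; apply/imsetP/imsetP => [[[u v]]|[i _ ->]].
  rewrite inE /= /C5_adj => /orP[] /eqP -> ->.
    by exists u.
  by exists v => //; rewrite finset.setUC.
by exists (i, i + 1) => //; rewrite inE /= /C5_adj eqxx.
Qed.

(** Otherwise [i = j + 1] and [j = i + 1], which forces 2 = 0 modulo 5. *)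
Lemma C5_edge_inj : injective (fun i : 'I_5 => [set i; i + 1]%SET).
Proof.
move=> i j /setP eij.
have /set2P[//|ij] : i \in [set j; j + 1]%SET by rewrite -eij set21.
have : j \in [set i; i + 1]%SET by rewrite eij set21.
case/set2P => // /eqP.
by rewrite ij -addrA -subr_eq0 opprD addrA subrr.
Qed.

Lemma sum_edges_C5 (R : comNzRingType) (f : 'I_5 -> R) :
  \sum_(e in edges C5) edge_val f e = \sum_i f i * f (i + 1).
Proof.
rewrite edges_C5 big_imset /=; last by move=> i j _ _; exact: C5_edge_inj.
apply: eq_bigr => i _.
by rewrite (@edge_valE _ _ C5) //= /C5_adj eqxx.
Qed.

Definition dir (b : bool) : 'I_5 := if b then 1 else -1.

(** Walking round the cycle from [v] in direction [dir b] lets one computation serve both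
    directions. *)
Lemma sum_I5_dir (R : nmodType) (F : 'I_5 -> R) (b : bool) (v : 'I_5) :
  \sum_i F i = F v + F (v + dir b) + F (v + dir b *+ 2)
                  + F (v - dir b *+ 2) + F (v - dir b).
Proof.
rewrite (reindex_inj (addrI v)) /= !big_ord_recl big_ord0 addr0 !addrA.
rewrite (_ : ord0 = 0) ?addr0; last exact: val_inj.
case: b; rewrite -(addrA v) /=; last rewrite [LHS](ACl (1*5*4*3*2)%AC) /=;
  by congr (_ + F _ + F _ + F _ + F _); congr (_ + _); apply: val_inj.
Qed.

Lemma sum_edges_C5_dir (R : comNzRingType) (f : 'I_5 -> R) (b : bool) :
  \sum_(e in edges C5) edge_val f e = \sum_i f i * f (i + dir b).
Proof.
rewrite sum_edges_C5; case: b => //=.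
rewrite [RHS](reindex_inj (addIr 1)) /=.
by apply: eq_bigr => i _; rewrite addrK mulrC.
Qed.

Section near_uniform_weight.
Variables (R : realType) (w : weight R 'I_5).
Hypothesis hw : forall v : 'I_5, `|w v - 1 / 5| <= 1 / 50.

Let rest (v : 'I_5) : R := 1 / 2 - (w (v + 1) + w (v - 1)).

Definition C5_half_fun (p : 'I_5 * bool) (i : 'I_5) : R :=
  let d := dir p.2 in
  if (i == p.1 + d) || (i == p.1 - d) then w i
  else if i == p.1 + d *+ 2 then rest p.1 else 0.

(** The residues 0, d, 2d, -2d, -d are distinct modulo 5. The product of equations allows all five
    values to be used in a single rewrite. *)
Lemma C5_half_funE v b (s := C5_half_fun (v, b)) (d := dir b) :
  (s v = 0) * (s (v + d) = w (v + d)) * (s (v + d *+ 2) = rest v)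
  * (s (v - d *+ 2) = 0) * (s (v - d) = w (v - d)).
Proof.
rewrite /s /C5_half_fun /= -/d.
have H (x y : 'I_5) : (v + x == v + y) = (x == y) by exact: (inj_eq (addrI v)).
have H0 (x : 'I_5) : (v == v + x) = (0 == x) by rewrite -{1}[v]addr0 H.
by rewrite !H !H0 /d; case: b s d.
Qed.

Lemma weight_bounds v : 18 / 100 <= w v <= 22 / 100.
Proof. by have := hw v; rewrite ler_norml => /andP[? ?]; apply/andP; lra. Qed.

(** The upper bound lies below 18/100, so the missing mass fits on any vertex; the lower bound gives
    nonnegativity and the uniformity estimate. *)
Lemma rest_bounds v : 6 / 100 <= rest v <= 14 / 100.
Proof.
have /andP[? ?] := weight_bounds (v + 1).
have /andP[? ?] := weight_bounds (v - 1).
by rewrite /rest; apply/andP; lra.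
Qed.

Lemma C5_half_ge0 p i : 0 <= C5_half_fun p i.
Proof.
rewrite /C5_half_fun; have /andP[? _] := weight_bounds i.
have /andP[? _] := rest_bounds p.1.
by case: ifP => _; [|case: ifP => _]; lra.
Qed.

Lemma C5_half_le p i : C5_half_fun p i <= w i.
Proof.
rewrite /C5_half_fun; have /andP[? _] := weight_bounds i.
have /andP[_ ?] := rest_bounds p.1.
by case: ifP => _; [|case: ifP => _]; lra.
Qed.

Lemma C5_half_sum p : \sum_i C5_half_fun p i = 1 / 2.
Proof.
case: p => v b; rewrite (sum_I5_dir _ b v) !C5_half_funE /rest.
by case: b; rewrite /= ?opprK; ring.
Qed.

Definition C5_half (p : 'I_5 * bool) : half_of w :=
  Half (C5_half_ge0 p) (C5_half_le p) (C5_half_sum p).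

Lemma C5_half_edges v b :
  \sum_(e in edges C5) edge_val (C5_half (v, b)) e = w (v + dir b) * rest v.
Proof.
rewrite (sum_edges_C5_dir _ b) (sum_I5_dir _ b v) /=.
rewrite -(addrA v (dir b)) -(mulr2n (dir b)) subrK !C5_half_funE.
(* Modulo 5, v + 3d is v - 2d, where the half vanishes. *)
rewrite (_ : v + _ + _ = v - dir b *+ 2) ?C5_half_funE; first by ring.
by rewrite -!addrA; congr (_ + _); case: b; apply: val_inj.
Qed.

(* Concavity of x (1/2 - x): it lies below its tangent at x = 2/5, the mean of
   the w(v+1) + w(v-1). *)
Lemma C5_half_sparse :
  \sum_p \sum_(e in edges C5) edge_val (C5_half p) e <= 1 / 5.
Proof.
rewrite -(pair_bigA _ (fun v b =>
  \sum_(e in edges C5) edge_val (C5_half (v, b)) e)) /=.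
apply: (@le_trans _ _
  (\sum_v (4 / 25 - 3 / 10 * (w (v + 1) + w (v - 1))))).
  apply: ler_sum => v _; rewrite big_bool /= !C5_half_edges /= /rest.
  set x := w _; set y := w _.
  have : 0 <= (x + y - 2 / 5) ^+ 2 by exact: sqr_ge0.
  by nra.
(* The tangent values add up to 5 * 4/25 - 3/10 * 2 = 1/5. *)
have sw c : \sum_v w (v + c) = 1.
  by rewrite -(weight_sum w) [RHS](reindex_inj (addIr c)).
rewrite sumrB sumr_const card_ord -mulr_sumr big_split /= !sw.
by lra.
Qed.

Lemma C5_half_uniform i :
  1 / 3 * (w i * w (i + 1))
    <= \sum_p C5_half_fun p i * C5_half_fun p (i + 1).
Proof.
have ne : (i + 1 + 1, false) != (i - 1, true).
  by rewrite xpair_eqE andbF.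
(* These two halves have v + d and v + 2d as the ends of the edge; for the other eight,
   nonnegativity is enough. *)
rewrite (bigD1 (i - 1, true)) // (bigD1 (i + 1 + 1, false)) //=.
set t := \sum_(_ | _) _.
have t0 : 0 <= t by apply: sumr_ge0 => p _; rewrite mulr_ge0 ?C5_half_ge0.
have := C5_half_funE (i - 1) true; rewrite /= mulr2n (addrA (i - 1)) subrK => E1.
have := C5_half_funE (i + 1 + 1) false.
rewrite /= opprK mulr2n (addrA (i + 1 + 1)) !addrK => E2; rewrite !E1 !E2.
have /andP[r1 _] := rest_bounds (i - 1).
have /andP[r2 _] := rest_bounds (i + 1 + 1).
have /andP[? ?] := weight_bounds i.
have /andP[? ?] := weight_bounds (i + 1).
have : 6 / 100 * w i <= w i * rest (i - 1) by rewrite mulrC ler_wpM2l //; lra.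
have : 6 / 100 * w (i + 1) <= rest (i + 1 + 1) * w (i + 1).
  by rewrite ler_wpM2r //; lra.
(* Bounding one factor leaves a linear inequality: 22/300 [w i] is at most 6/100
   [(w i + w (i + 1))]. *)
have : w i * w (i + 1) <= w i * (22 / 100) by rewrite ler_wpM2l //; lra.
by lra.
Qed.

End near_uniform_weight.

Theorem theorem5p5 (R : realType) (w : weight R 'I_5)
    (hw : forall v : 'I_5, `|w v - 1 / 5| <= 1 / 50) :
  has_uniform_sparse_half C5 w (1 / 30).
Proof.
have [P PE] :=
  @uniform_mixture _ (halves w) R _ (0, true) (C5_half hw : _ -> halves w).
(* Averaging over ten halves turns the sum bounds 1/3 and 1/5 into 1/30 and 1/50. *)
have card10 : #|(('I_5 * bool)%type : finType)| = 10.
  by rewrite card_prod card_ord card_bool.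
exists P; split=> [e|].
  rewrite edges_C5 => /imsetP[i _ ->].
  rewrite PE; [|exact: measurable_edge_val|by move=> s; exact: edge_val_half_ge0].
  have Gi : C5 i (i + 1) by rewrite /= /C5_adj eqxx.
  rewrite lee_fin (edge_valE w Gi) card10.
  under eq_bigr do rewrite (edge_valE _ Gi).
  by have := C5_half_uniform hw i; lra.
rewrite PE; first 1 last.
- under eq_fun do rewrite -big_enum /=.
  by apply: measurable_sum => e; exact: measurable_edge_val.
- by move=> s; apply: sumr_ge0 => e _; exact: edge_val_half_ge0.
by rewrite lee_fin card10; have := C5_half_sparse hw; lra.
Qed.
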